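(* Let $z(\zeta)=D\zeta+r$ be an AAR solution of the uncertain LCP $$0\le z(\zeta)\perp M(\zeta)z(\zeta)+q\ge 0\quad\text{for all }\zeta\in\mathcal{U},$$ and let $J=\{j\in[n]:r_j>0\}$ and $N=[n]\setminus J$. If $M^0_J$ is invertible, then $D$ and $r$ are given by $$D_{J,i}=\tilde M^{J,i}q_J\ (i\in[k]),\quad r_J=-(M^0_J)^{-1}q_J,\quad D_{N,\cdot}=0,\quad r_N=0.$$
   Context: Notation: $[n]=\{1,\dots,n\}$. For a matrix $A$ and index sets $I,J$, $A_{I,J}$ is the submatrix with rows in $I$ and columns in $J$, $A_I=A_{I,I}$ (so $M^i_J=(M^i)_{J,J}$), and $A_{I,\cdot}$ consists of the rows in $I$; $D_{J,i}$ is the subvector, indexed by $J$, of the $i$-th column of $D$; $b_I$ is the subvector of $b$ indexed by $I$. Vector inequalities are componentwise, and $0\le a\perp b\ge 0$ means $a\ge0$, $b\ge0$, $a^\top b=0$. Data: matrices $M^0,M^1,\dots,M^k\in\mathbb{R}^{n\times n}$, $q\in\mathbb{R}^n$, $h\in\{0,\dots,n\}$, the uncertainty set $\mathcal{U}=[-1,1]^k$, and $M(\zeta)=M^0+\sum_{i=1}^k\zeta_iM^i$ for $\zeta\in\mathcal{U}$. For $I\subseteq[n]$ with $M^0_I$ invertible and $i\in[k]$, define $\tilde M^{I,i}=(M^0_I)^{-1}M^i_I(M^0_I)^{-1}$. An affinely adjustable robust (AAR) solution of this uncertain LCP is an affine function $z(\zeta)=D\zeta+r$ with $D\in\mathbb{R}^{n\times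 k}$, $r\in\mathbb{R}^n$ and $D_{[h],\cdot}=0$ (the first $h$ rows of $D$ are zero), such that $0\le z(\zeta)\perp M(\zeta)z(\zeta)+q\ge0$ for all $\zeta\in\mathcal{U}$. *)

(* Defs.v *)
From mathcomp Require Import all_boot all_order all_algebra.
From mathcomp Require Import reals.

Set Implicit Arguments.
Unset Strict Implicit.
Unset Printing Implicit Defensive.

Import Order.TTheory GRing.Theory Num.Theory.
Local Open Scope ring_scope.

(* [n] is represented by 'I_n, shifted to 0, ..., n-1.  The rows and columns
   of A_{I,J} and the entries of b_I are listed in increasing order of index,
   as given by enum_val. *)
Definition sub_rows (R : realType) (n m : nat) (I : {set 'I_n})
    (A : 'M[R]_(n, m)) : 'M[R]_(#|I|, m) :=
  rowsub (fun i : 'I_#|I| => enum_val i) A.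

Definition sub_mx (R : realType) (n m : nat) (I : {set 'I_n}) (J : {set 'I_m})
    (A : 'M[R]_(n, m)) : 'M[R]_(#|I|, #|J|) :=
  mxsub (fun i : 'I_#|I| => enum_val i) (fun j : 'I_#|J| => enum_val j) A.

Definition principal_mx (R : realType) (n : nat) (I : {set 'I_n})
    (A : 'M[R]_n) : 'M[R]_#|I| :=
  sub_mx I I A.

Definition vec_ge0 (R : realType) (n : nat) (a : 'cV[R]_n) : Prop :=
  forall j : 'I_n, 0 <= a j 0.

Definition complementary (R : realType) (n : nat) (a b : 'cV[R]_n) : Prop :=
  [/\ vec_ge0 a, vec_ge0 b & a^T *m b = 0].

Definition in_box (R : realType) (k : nat) (zeta : 'cV[R]_k) : Prop :=
  forall i : 'I_k, -1 <= zeta i 0 <= 1.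

Definition uncertain_mx (R : realType) (n k : nat) (M0 : 'M[R]_n)
    (M : 'I_k -> 'M[R]_n) (zeta : 'cV[R]_k) : 'M[R]_n :=
  M0 + \sum_(i < k) zeta i 0 *: M i.

Definition affine_map (R : realType) (n k : nat) (D : 'M[R]_(n, k))
    (r : 'cV[R]_n) (zeta : 'cV[R]_k) : 'cV[R]_n :=
  D *m zeta + r.

(* The first h variables are the non-adjustable ones: their rows in D vanish. *)
Definition AAR_solution (R : realType) (n k : nat) (M0 : 'M[R]_n)
    (M : 'I_k -> 'M[R]_n) (q : 'cV[R]_n) (h : nat)
    (D : 'M[R]_(n, k)) (r : 'cV[R]_n) : Prop :=
  (forall (j : 'I_n) (i : 'I_k), (j < h)%N -> D j i = 0) /\
  (forall zeta : 'cV[R]_k, in_box zeta ->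
     complementary (affine_map D r zeta)
       (uncertain_mx M0 M zeta *m affine_map D r zeta + q)).

Definition tilde_mx (R : realType) (n : nat) (M0 : 'M[R]_n) (I : {set 'I_n})
    (Mi : 'M[R]_n) : 'M[R]_#|I| :=
  invmx (principal_mx I M0) *m principal_mx I Mi *m invmx (principal_mx I M0).

(* Main.v *)
(* Along each coordinate line zeta = t e_i, |t| <= 1, the solution r + t D_i is
   affine and nonnegative.  A coordinate with r_j = 0 must therefore be constant
   (look at t = 1 and t = -1), while one with r_j > 0 stays positive for |t| < 1,
   so that the residual (M(t e_i) z + q)_j, a quadratic polynomial in t, vanishes
   there by complementarity.  Its constant and linear coefficients yield
   M^0_J r_J = - q_J and M^0_J D_{J,i} = - M^i_J r_J. *)
Require Import Defs.
From mathcomp Require Import all_boot all_order all_algebra.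
From mathcomp Require Import reals ring lra.

Import Order.TTheory GRing.Theory Num.Theory.
Local Open Scope ring_scope.

(** A sum of nonnegative products is zero only if each product is. *)
Lemma complementary_entry {R : realType} {n : nat} {a b : 'cV[R]_n} :
  complementary a b -> forall j : 'I_n, a j 0 * b j 0 = 0.
Proof.
move=> [a0 b0 /matrixP/(_ 0 0)]; rewrite !mxE => ab j.
apply/eqP; move/eqP: ab; rewrite psumr_eq0 => [/allP/(_ j)|l _].
  by rewrite mem_index_enum mxE; apply.
by rewrite mxE mulr_ge0.
Qed.

(** Columns of [A] outside [I] meet only zero rows of [B], so the block indexed by [I] carries the
    whole product. *)
Lemma sub_rows_mulmx {R : realType} {n m : nat} (I : {set 'I_n})
    (A : 'M[R]_n) (B : 'M[R]_(n, m)) :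
  (forall (j : 'I_n) (l : 'I_m), j \notin I -> B j l = 0) ->
  sub_rows I (A *m B) = principal_mx I A *m sub_rows I B.
Proof.
move=> B0; apply/matrixP => a l; rewrite !mxE.
rewrite (bigID (mem I)) /= [X in _ + X]big1 => [|j jI]; last first.
  by rewrite B0 ?mulr0.
rewrite addr0 big_enum_val /=.
by apply: eq_bigr => b _; rewrite !mxE.
Qed.

Lemma sub_rows_eq0 {R : realType} {n m : nat} (I : {set 'I_n})
    (A : 'M[R]_(n, m)) :
  (forall (j : 'I_n) (l : 'I_m), j \in I -> A j l = 0) -> sub_rows I A = 0.
Proof.
by move=> A0; apply/matrixP => a l; rewrite !mxE A0 ?enum_valP.
Qed.

Section CoordinateLine.
Context {R : realType} {n k : nat}.
Implicit Types (M : 'I_k -> 'M[R]_n) (D : 'M[R]_(n, k)) (r q : 'cV[R]_n).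

Lemma in_box_line (i : 'I_k) (t : R) :
  -1 <= t <= 1 -> in_box (t *: delta_mx i 0 : 'cV[R]_k).
Proof.
move=> t1 l; rewrite !mxE andbT; case: eqP => _; rewrite ?mulr1 ?mulr0 //.
by rewrite lerN10 ler01.
Qed.

Lemma affine_map_line D r (i : 'I_k) (t : R) :
  affine_map D r (t *: delta_mx i 0) = r + t *: col i D.
Proof. by rewrite /affine_map -scalemxAr -colE addrC. Qed.

Lemma uncertain_mx_line (M0 : 'M[R]_n) M (i : 'I_k) (t : R) :
  uncertain_mx M0 M (t *: delta_mx i 0) = M0 + t *: M i.
Proof.
rewrite /uncertain_mx (bigD1 i) //= big1 ?addr0 => [|l li].
  by rewrite !mxE !eqxx mulr1.
by rewrite !mxE (negbTE li) mulr0 scale0r.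
Qed.

Lemma residual_line (M0 : 'M[R]_n) M q D r (i : 'I_k) (t : R) :
  uncertain_mx M0 M (t *: delta_mx i 0) *m affine_map D r (t *: delta_mx i 0)
    + q =
  (M0 *m r + q) + t *: (M0 *m col i D + M i *m r)
    + t ^+ 2 *: (M i *m col i D).
Proof.
rewrite affine_map_line uncertain_mx_line mulmxDl !mulmxDr -!scalemxAl.
rewrite -!scalemxAr.
(* Generalizing the four products keeps [mxE] from unfolding them into sums. *)
move: (M0 *m r) (M0 *m col i D) (M i *m r) (M i *m col i D) => a b c d.
by apply/matrixP => j l; rewrite !mxE; ring.
Qed.

End CoordinateLine.

Section AAR.
Context {R : realType} {n k : nat}.
Context {M0 : 'M[R]_n} {M : 'I_k -> 'M[R]_n} {q : 'cV[R]_n} {h : nat}.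
Context {D : 'M[R]_(n, k)} {r : 'cV[R]_n}.
Context (aar : AAR_solution M0 M q h D r).

Lemma AAR_line_ge0 (i : 'I_k) (j : 'I_n) (t : R) :
  -1 <= t <= 1 -> 0 <= r j 0 + t * D j i.
Proof.
move=> /(in_box_line i)/(proj2 aar)[+ _ _] => /(_ j).
by rewrite affine_map_line !mxE.
Qed.

Lemma AAR_residual_coef_eq0 (i : 'I_k) (j : 'I_n) : 0 < r j 0 ->
  (M0 *m col i D + M i *m r) j 0 = 0.
Proof.
move=> rj.
have res0 t : -1 < t < 1 ->
    (M0 *m r + q) j 0 + t * (M0 *m col i D + M i *m r) j 0
      + t ^+ 2 * (M i *m col i D) j 0 = 0.
  move=> /andP[t1 t2].
  have t12 : -1 <= t <= 1 by rewrite !ltW.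
  have := complementary_entry (proj2 aar _ (in_box_line i t t12)) j.
  rewrite residual_line affine_map_line => /eqP; rewrite mulf_eq0.
  case/orP => [/eqP|/eqP]; last by rewrite !mxE.
  rewrite !mxE => zj0.
  have zp := AAR_line_ge0 i j 1 ltac:(apply/andP; split; lra).
  have zm := AAR_line_ge0 i j (-1) ltac:(apply/andP; split; lra).
  (* For [D j i] positive, [t > -1] gives [r j 0 + t * D j i > r j 0 - D j i >= 0]; the negative
     case is symmetric, and for zero the value is [r j 0 > 0]. *)
  by exfalso; case: (ltrgtP (D j i) 0) => Dji; nra.
(* The constant and quadratic terms are even in [t], so the difference of the values at 1/2 and -1/2
   is exactly the linear coefficient. *)
have h1 := res0 (1 / 2); have h2 := res0 (- (1 / 2)).
have {}h1 := h1 ltac:(apply/andP; split; lra).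
have {}h2 := h2 ltac:(apply/andP; split; lra).
lra.
Qed.

(** The point [zeta = 0] is used directly rather than through a coordinate line, since for [k = 0]
    there are no such lines. *)
Lemma AAR_nominal (j : 'I_n) :
  0 <= r j 0 /\ (0 < r j 0 -> (M0 *m r + q) j 0 = 0).
Proof.
have box0 : in_box (0 : 'cV[R]_k) by move=> l; rewrite mxE lerN10 ler01.
have C := proj2 aar _ box0.
have E : affine_map D r 0 = r by rewrite /affine_map mulmx0 add0r.
have F : uncertain_mx M0 M 0 = M0.
  by rewrite /uncertain_mx big1 ?addr0 // => l _; rewrite mxE scale0r.
rewrite E F in C; split; first by case: C => /(_ j).
move=> rj; have /eqP := complementary_entry C j.
by rewrite mulf_eq0 gt_eqF //= => /eqP.
Qed.

Lemma AAR_inactive (j : 'I_n) : ~~ (0 < r j 0) ->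
  r j 0 = 0 /\ forall i : 'I_k, D j i = 0.
Proof.
rewrite -leNgt => rj; have rj0 := proj1 (AAR_nominal j).
split=> [|i]; first lra.
have zp := AAR_line_ge0 i j 1 ltac:(apply/andP; split; lra).
have zm := AAR_line_ge0 i j (-1) ltac:(apply/andP; split; lra).
lra.
Qed.

End AAR.

Theorem corollary4 (R : realType) (n k : nat) (M0 : 'M[R]_n)
    (M : 'I_k -> 'M[R]_n) (q : 'cV[R]_n) (h : nat) (le_hn : (h <= n)%N)
    (D : 'M[R]_(n, k)) (r : 'cV[R]_n) :
  AAR_solution M0 M q h D r ->
  let J := [set j : 'I_n | 0 < r j 0] in
  let N := ~: J in
  principal_mx J M0 \in unitmx ->
  [/\ forall i : 'I_k,
        sub_rows J (col i D) = tilde_mx M0 J (M i) *m sub_rows J q,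
      sub_rows J r = - (invmx (principal_mx J M0) *m sub_rows J q),
      sub_rows N D = 0
    & sub_rows N r = 0].
Proof.
move=> aar J N M0J_unit.
(* Vanishing outside [J] yields both claims on [N] and lets restriction to [J] pass through the
   matrix products. *)
have r0 (j : 'I_n) (l : 'I_1) : j \notin J -> r j l = 0.
  by rewrite inE ord1 => /(AAR_inactive aar)[].
have D0 (j : 'I_n) (i : 'I_k) : j \notin J -> D j i = 0.
  by rewrite inE => /(AAR_inactive aar)[].
have colD0 (i : 'I_k) (j : 'I_n) (l : 'I_1) : j \notin J -> col i D j l = 0.
  by rewrite mxE; apply: D0.
have rJ : sub_rows J r = - (invmx (principal_mx J M0) *m sub_rows J q).
  rewrite -mulmxN; apply: (canRL (mulKmx M0J_unit)).
  rewrite -sub_rows_mulmx //; apply/eqP; rewrite -addr_eq0 -linearD /=.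
  apply/eqP/sub_rows_eq0 => j l; rewrite inE ord1.
  exact: (proj2 (AAR_nominal aar j)).
split=> // [i||]; last 2 first.
- by apply: sub_rows_eq0 => j l; rewrite inE; apply: D0.
- by apply: sub_rows_eq0 => j l; rewrite inE; apply: r0.
rewrite /tilde_mx -!mulmxA; apply: (canRL (mulKmx M0J_unit)).
rewrite -sub_rows_mulmx; last exact: colD0.
(* Recognizing the inverse applied to [sub_rows J q] as [- sub_rows J r] turns the goal into the
   vanishing of the linear coefficient on [J]. *)
apply/eqP; rewrite -[X in _ == _ *m X]opprK -rJ mulmxN -sub_rows_mulmx //.
rewrite -addr_eq0 -linearD /=.
apply/eqP/sub_rows_eq0 => j l; rewrite inE ord1.
exact: AAR_residual_coef_eq0 aar i j.
Qed.
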